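(* Let $h(n)$, $n\ge 1$, be the integers defined by $\sum_{n=1}^{\infty} h(n)q^n=\sum_{n=1}^{\infty}\frac{(-1)^{n+1}q^{n(n+1)/2}}{1-q^n}$. Then: (1) For all sufficiently large $X$, $$\frac{\sqrt{X}}{\log X}\ll\#\{1\le n\le X : h(n)=2\}<\frac{X}{2}+\left(\frac{3}{2}+\sqrt{2}\right)\sqrt{X}+1+\frac{3\sqrt{2}}{2}.$$ (2) If $n=p_1p_2$, where $p_1$ and $p_2$ are odd primes with $p_1<p_2<2p_1$, then $h(n)=2$. (3) If $n=p(p+1)$ or $n=(p-1)p$, where $p$ is an odd prime, then $h(n)=2$.
   Context: The identity defining $h(n)$ is an identity of formal power series in $q$, with each $\frac{1}{1-q^n}$ expanded as $\sum_{m\ge 0}q^{nm}$. In the counting function, $n$ ranges over positive integers. The notation $f(X)\ll g(X)$ means that there is an absolute constant $c>0$ such that $c\,f(X)\le g(X)$ for all sufficiently large $X$. *)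

(* Defs.v *)
From HB Require Import structures.
From mathcomp Require Import all_boot all_order all_algebra.
From mathcomp Require Import all_classical all_reals all_analysis.

Set Implicit Arguments.
Unset Strict Implicit.
Unset Printing Implicit Defensive.

Import Order.TTheory GRing.Theory Num.Theory.
Import numFieldNormedType.Exports.

Local Open Scope classical_set_scope.
Local Open Scope ring_scope.

(* Formal power series in q over the integers, given by their coefficients:
   [f k] is the coefficient of q^k.  The product is the Cauchy product
   [fps_mul], not the pointwise product of functions. *)
Definition fps := nat -> int.

Definition fps_monomial (a : int) (n : nat) : fps :=
  fun k => if k == n then a else 0.

Definition fps_mul (f g : fps) : fps :=
  fun k => \sum_(i < k.+1) f i * g (k - i)%N.

(* S = \sum_(n >= m) F n in the q-adic topology: every coefficient of the
   partial sums is eventually equal to that of S. *)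
Definition is_fps_sum (m : nat) (F : nat -> fps) (S : fps) : Prop :=
  forall k : nat, \forall N \near \oo, \sum_(m <= n < N) F n k = S k.

(* 1 / (1 - q^n) for n > 0; see fps_geom_sum and fps_geom_inv. *)
Definition fps_geom (n : nat) : fps := fun k => (n %| k)%:R.

Definition rhs_term (n : nat) : fps :=
  fps_mul (fps_monomial ((-1) ^+ n.+1) (n * n.+1)./2) (fps_geom n).

(* h 0 is left unconstrained. *)
Definition h_identity (h : nat -> int) : Prop :=
  exists S : fps,
    is_fps_sum 1 (fun n => fps_monomial (h n) n) S /\ is_fps_sum 1 rhs_term S.

(* Num.truncn X is the floor of X for X >= 0, and 0 for X < 0. *)
Definition count_eq2 (R : realType) (h : nat -> int) (X : R) : nat :=
  #|[set n : 'I_(Num.truncn X).+1 | (1 <= n)%N && (h n == 2)]%SET|.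

Definition asymp_ll (R : realType) (f g : R -> R) : Prop :=
  exists2 c : R, 0 < c & \forall X \near +oo_R, c * f X <= g X.

Lemma fps_geom_sum (n : nat) : (0 < n)%N ->
  is_fps_sum 0 (fun m => fps_monomial 1 (n * m)) (fps_geom n).
Proof.
move=> n0 k; exists k.+1 => // N /= kN; rewrite /fps_monomial /fps_geom.
rewrite big_mkord.
have [/dvdnP[d kd]|nk] := boolP (n %| k)%N; last first.
  by rewrite big1// => i _; case: eqP => // ki; rewrite ki dvdn_mulr in nk.
have dN : (d < N)%N.
  by apply: leq_trans kN; rewrite ltnS kd leq_pmulr.
rewrite (bigD1 (Ordinal dN))//= kd mulnC eqxx big1 ?addr0// => i id.
case: eqP => // /eqP; rewrite eqn_pmul2l// => /eqP di.
by move/eqP: id; case; apply: val_inj.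
Qed.

Lemma fps_mul_monomial (a : int) (n : nat) (g : fps) (k : nat) :
  fps_mul (fps_monomial a n) g k = if (n <= k)%N then a * g (k - n)%N else 0.
Proof.
rewrite /fps_mul /fps_monomial; case: leqP => nk.
  have nk' : (n < k.+1)%N by [].
  rewrite (bigD1 (Ordinal nk'))//= eqxx big1 ?addr0// => i ni.
  case: eqP => [ni'|]; last by rewrite mul0r.
  by move/eqP: ni; case; apply: val_inj.
rewrite big1// => i _; case: eqP => [ni|]; last by rewrite mul0r.
by have := ltn_ord i; rewrite ni ltnS leqNgt nk.
Qed.

Lemma fps_geom_inv (n : nat) : (0 < n)%N ->
  fps_mul (fun k => fps_monomial 1 0 k - fps_monomial 1 n k) (fps_geom n)
  = fps_monomial 1 0.
Proof.
move=> n0; apply/funext => k.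
have -> : fps_mul (fun k => fps_monomial 1 0 k - fps_monomial 1 n k)
    (fps_geom n) k = fps_mul (fps_monomial 1 0) (fps_geom n) k -
                     fps_mul (fps_monomial 1 n) (fps_geom n) k.
  by rewrite /fps_mul -sumrB; apply: eq_bigr => i _; rewrite mulrBl.
rewrite !fps_mul_monomial leq0n subn0 !mul1r /fps_geom /fps_monomial.
case: leqP => nk.
  rewrite dvdn_subl// subrr gtn_eqF//; exact: leq_trans nk.
rewrite subr0; case: k nk => [|k] nk; first by rewrite dvdn0.
by rewrite gtnNdvd.
Qed.

Lemma h_identity_exists : exists h : nat -> int, h_identity h.
Proof.
pose h (k : nat) : int := \sum_(1 <= n < k.+1) rhs_term n k.
exists h, (fun k => h k); split => k; exists k.+1 => // N /= kN.
  rewrite /fps_monomial; case: k kN => [|k] kN.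
    rewrite /h [RHS]big_geq// big_nat big1// => i /andP[i0 _].
    by rewrite ltn_eqF.
  rewrite (bigD1_seq k.+1) ?mem_index_iota ?iota_uniq//= eqxx big1 ?addr0//.
  by move=> i ik; rewrite eq_sym (negbTE ik).
rewrite /h (big_cat_nat _ (n := k.+1))//= [X in _ + X]big_nat.
rewrite [X in _ + X]big1 ?addr0// => i /andP[ki _].
rewrite /rhs_term fps_mul_monomial ifF//; apply/negbTE; rewrite -ltnNge.
apply: leq_trans ki _; case: i => // i.
by rewrite -[leqLHS]doubleK half_leq// -muln2 leq_mul2l.
Qed.

Lemma h_identity_unique (h1 h2 : nat -> int) :
  h_identity h1 -> h_identity h2 -> forall n, (1 <= n)%N -> h1 n = h2 n.
Proof.
have coefE h S n : (1 <= n)%N ->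
    is_fps_sum 1 (fun n => fps_monomial (h n) n) S -> S n = h n.
  move=> n1 /(_ n)[N _ /(_ (maxn N n.+1))] /=.
  move=> /(_ (leq_maxl _ _)) <-; rewrite /fps_monomial.
  rewrite (bigD1_seq n) ?mem_index_iota ?iota_uniq ?n1 ?leq_maxr//=.
  by rewrite eqxx big1 ?addr0// => i ik; rewrite eq_sym (negbTE ik).
move=> [S1 [hS1 rS1]] [S2 [hS2 rS2]] n n1.
rewrite -(coefE _ _ _ n1 hS1) -(coefE _ _ _ n1 hS2).
have [N1 _ E1] := rS1 n; have [N2 _ E2] := rS2 n.
rewrite -(E1 (maxn N1 N2)) /= ?leq_maxl//.
by rewrite -(E2 (maxn N1 N2)) //= leq_maxr.
Qed.

(* Main.v *)
Require Import Defs.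
From HB Require Import structures.
From mathcomp Require Import all_boot all_order all_algebra.
From mathcomp Require Import all_classical all_reals all_analysis.
From mathcomp Require Import zify ring lra.

(** The [i]-th term of the series, q^(T_i) / (1 - q^i) with T_i = i(i+1)/2,
contributes to q^n exactly when n = T_i + i m with m >= 0, that is when
2n = i (i + 1 + 2m).  So [h n] is a signed count of the factorizations
2n = i q with i < q and i, q of opposite parity, the sign being + for odd i
and - for even i.  Write 2n = 2^a k with k odd.  The odd divisors i of 2n are
the divisors d of k; the even ones with an odd cofactor are the products
2^a d.  The even term of d is subtracted only when the odd term of d is
present, so everything cancels except the divisors d of k with
k/d < 2^a d and d < 2^a (k/d): [h n] counts the divisors of k that are central
up to a factor 2^a ([h_central_divisors]).  In particular [h n] >= 0.

Values equal to 2.  If k = p m with p prime and m < p, then m and p are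
central as soon as p < 2^a m, and no other divisor is central when
2^a m < 9 p, because a proper divisor of the odd number m is at most m / 3
([h_prime_mul_eq2]).  Both explicit families are of this form: n = p1 p2 has
a = 1, and n = p (p +- 1) has 2^a m = 2 (p +- 1).

Upper bound.  Summed over 1 <= n <= N, the coefficients become an alternating
sum of decreasing terms, the number of m with T_i + i m <= N, so it is at most
its first term, N ([sum_h_le]).  As [h] is nonnegative, at most N / 2 of its
values equal 2, which is stronger than the stated bound.

Lower bound.  The numbers p (p + 1) with p an odd prime and p (p + 1) <= X
suffice, by a Chebyshev estimate: 2^n <= 'C(2n, n), while each prime power
dividing 'C(2n, n) is at most 2n, so 'C(2n, n) <= (2n)^pi(2n).  Taking 2n
comparable to the square root of X gives the claim. *)

Set Implicit Arguments.
Unset Strict Implicit.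
Unset Printing Implicit Defensive.

Import Order.TTheory GRing.Theory Num.Theory.
Import numFieldNormedType.Exports.

Local Open Scope classical_set_scope.
Local Open Scope ring_scope.

(** * Coefficients as signed counts of factorizations *)

Definition triangular (i : nat) : nat := (i * i.+1)./2.
Arguments triangular : simpl never.

Lemma triangular_double i : (triangular i).*2 = (i * i.+1)%N.
Proof.
rewrite /triangular -[RHS]odd_double_half.
by rewrite [odd _](_ : _ = false) ?add0n// oddM oddS; case: (odd i).
Qed.

Lemma leq_triangular i : (i <= triangular i)%N.
Proof. by rewrite -leq_double triangular_double; nia. Qed.

(** Whether q^n occurs in the expansion of q^(T_i) / (1 - q^i), for i > 0. *)
Definition progression_mem (i n : nat) : bool :=
  (triangular i <= n)%N && (i %| n - triangular i)%N.

(** Terms with i > n do not reach q^n, since T_i >= i; hence any cutoff [N]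
beyond [n] gives the same sum, and one [N] can serve all n <= N. *)
Lemma h_alternating_count (h : nat -> int) (n N : nat) :
  h_identity h -> (0 < n)%N -> (n < N)%N ->
  h n = \sum_(1 <= i < N) (-1) ^+ i.+1 * (progression_mem i n)%:R.
Proof.
move=> [S [hS rS]] n0 nN.
have -> : h n = S n.
  have [M _ /(_ (maxn M n.+1) (leq_maxl _ _)) <-] := hS n.
  rewrite /fps_monomial (bigD1_seq n) ?mem_index_iota ?iota_uniq ?n0 ?leq_maxr//=.
  by rewrite eqxx big1 ?addr0// => i ik; rewrite eq_sym (negbTE ik).
have [M _ /(_ (maxn M N) (leq_maxl _ _)) <-] := rS n.
have E i : rhs_term i n = (-1) ^+ i.+1 * (progression_mem i n)%:R.
  rewrite /rhs_term fps_mul_monomial /progression_mem /fps_geom -/(triangular i).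
  by case: ifP; rewrite ?mulr0.
rewrite (big_cat_nat _ (n := N)) ?leq_maxr//=; last exact: leq_trans nN.
rewrite [X in _ + X]big_nat [X in _ + X]big1 ?addr0.
  by apply: eq_bigr => i _.
move=> i /andP[Ni _]; rewrite E /progression_mem leqNgt.
by rewrite (leq_trans nN) ?mulr0// (leq_trans Ni) ?leq_triangular.
Qed.

(** The cofactor of i in 2n = 2 T_i + 2 i m is i + 1 + 2m, and m ranges over the
naturals: this is the whole content of the inequality and of the parity. *)
Lemma progression_memE (i n : nat) : (0 < i)%N ->
  progression_mem i n =
  [&& (i %| n.*2)%N, (i < n.*2 %/ i)%N & odd (i + n.*2 %/ i)].
Proof.
move=> i0; have T := triangular_double i; rewrite /progression_mem.
apply/andP/and3P => [[Tn /dvdnP[m nm]]|[/dvdnP[q nq]]].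
  have E : n.*2 = ((i + m.*2.+1) * i)%N by nia.
  rewrite E mulnK// dvdn_mull//; split => //; first by lia.
  by rewrite addnA addnn oddD odd_double oddS odd_double.
rewrite nq mulnK// => iq oiq.
have [m qE] : exists m, q = (i + m.*2.+1)%N.
  by exists (q - i).-1./2; lia.
have E : n = (triangular i + m * i)%N by nia.
by rewrite E leq_addr addKn dvdn_mull.
Qed.

(** * The sum of h over an initial segment *)

(** Counting by the witness m makes the sum over n trivial once the order of
summation is exchanged. *)
Lemma progression_mem_sum (i n N : nat) : (0 < i)%N -> (n < N)%N ->
  progression_mem i n = (\sum_(m < N) (n == triangular i + i * m))%N :> nat.
Proof.
move=> i0 nN; rewrite /progression_mem.
case: leqP => Tn /=; last first.
  by rewrite big1// => m _; case: eqP => // E; move: Tn; rewrite E; lia.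
have [/dvdnP[m nm]|ndvd] := boolP (i %| _)%N; last first.
  rewrite big1// => m _; case: eqP => // E; move: ndvd.
  by rewrite E addKn dvdn_mulr.
have mN : (m < N)%N by nia.
rewrite (bigD1 (Ordinal mN))//= big1 => [|j /eqP jm].
  by rewrite addn0 mulnC -nm subnKC// eqxx.
case: eqP => // E; case: jm; apply: val_inj; apply/eqP.
by rewrite /= -(eqn_pmul2l i0) [eqbRHS]mulnC -nm E addKn.
Qed.

Lemma alternating_sum_bounds (c : nat -> int) (N : nat) :
  (forall i, 0 <= c i) -> (forall i, c i.+1 <= c i) ->
  0 <= \sum_(i < N) (-1) ^+ i * c i <= c 0%N.
Proof.
elim: N c => [|N IH] c c0 cS; first by rewrite big_ord0 lexx c0.
rewrite big_ord_recl expr0 mul1r.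
under eq_bigr => i _ do rewrite lift0 exprS mulN1r mulNr.
rewrite sumrN; have := IH (fun i => c i.+1) (fun i => c0 _) (fun i => cS _).
move: (\sum_(i < N) _) (cS 0%N) => s c1 /= /andP[s0 sc].
by rewrite subr_ge0 (le_trans sc)//= lerBlDr lerDl.
Qed.

(** The i = 1 term is 1 / (1 - q) without its constant term, which contributes
exactly N; the alternating sum cannot exceed it. *)
Lemma sum_h_le (h : nat -> int) (N : nat) : h_identity h ->
  \sum_(1 <= n < N.+1) h n <= N%:R.
Proof.
move=> hh.
pose c (i : nat) : int :=
  (\sum_(m < N.+1) (triangular i.+1 + i.+1 * m <= N))%N%:R.
have -> : \sum_(1 <= n < N.+1) h n = \sum_(i < N) (-1) ^+ i * c i.
  transitivity (\sum_(1 <= n < N.+1)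
      \sum_(i < N) (-1) ^+ i * (progression_mem i.+1 n)%:R : int).
    rewrite [LHS]big_nat [RHS]big_nat; apply: eq_bigr => n /andP[n0 nN].
    rewrite (h_alternating_count hh n0 nN) big_add1 big_mkord.
    by apply: eq_bigr => i _; rewrite !exprS !mulN1r opprK.
  rewrite exchange_big; apply: eq_bigr => i _; rewrite -mulr_sumr; congr (_ * _).
  rewrite -natr_sum; congr _%:R.
  transitivity (\sum_(1 <= n < N.+1)
      \sum_(m < N.+1) (n == triangular i.+1 + i.+1 * m))%N.
    rewrite [LHS]big_nat [RHS]big_nat; apply: eq_bigr => n /andP[n0 nN].
    exact: progression_mem_sum.
  rewrite exchange_big; apply: eq_bigr => m _ /=.
  set t := (_ + _)%N; have t0 : (0 < t)%N.
    by rewrite /t; have := leq_triangular i.+1; lia.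
  case: (leqP t N) => tN.
    rewrite (bigD1_seq t) ?mem_index_iota ?iota_uniq ?t0 ?ltnS//= eqxx big1//.
    by move=> n /negbTE ->.
  rewrite big_nat big1// => n /andP[_ nN]; case: eqP => // nt; lia.
have /andP[_ /le_trans] : 0 <= \sum_(i < N) (-1) ^+ i * c i <= c 0%N.
  apply: alternating_sum_bounds => i; rewrite /c ?ler0n// ler_nat.
  apply: leq_sum => m _.
  have lt : (triangular i.+1 + i.+1 * m <= triangular i.+2 + i.+2 * m)%N.
    by rewrite leq_add ?leq_mul// /triangular half_leq ?leq_mul.
  by case: (leqP (triangular i.+2 + _)%N N) => // /(leq_trans lt) ->.
apply; rewrite /c ler_nat big_ord_recr /=
  [X in (_ + nat_of_bool X)%N](_ : _ = false).
  rewrite addn0 -[leqRHS]card_ord -sum1_card.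
  by apply: leq_sum => i _; apply: leq_b1.
by rewrite /triangular/=; lia.
Qed.

(** * Central divisors *)

(** The complementary divisors [d] and [k %/ d] are within a factor [A] of each
other.  In use, [A] is even and [k] odd, so equality never arises. *)
Definition central_divisor (A k d : nat) : bool :=
  (d < A * (k %/ d))%N && (k %/ d < A * d)%N.

(** Cancellation of the term of [2 ^ a * d] against the term of [d], for [d]
dividing the odd part of 2n: among these, what survives are the divisors for
which the odd term is present and the even one is not. *)
Lemma h_central_divisors (h : nat -> int) (n a k : nat) :
  h_identity h -> (0 < n)%N -> odd k -> n.*2 = (2 ^ a * k)%N ->
  h n = (count (central_divisor (2 ^ a) k) (divisors k))%:R.
Proof.
move=> hh n0 ok nk; pose A := (2 ^ a)%N; rewrite -/A in nk *.
have k0 : (0 < k)%N by case: (k) ok.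
have A0 : (0 < A)%N by rewrite expn_gt0.
have a0 : (0 < a)%N.
  rewrite lt0n; apply/eqP => a0.
  by move: (congr1 odd nk); rewrite /A a0 mul1n odd_double ok.
have evA : odd A = false by rewrite /A oddX/= orbF -leqn0 leqNgt a0.
rewrite (@h_alternating_count h n n.*2.+1)//; last by lia.
have coA i : odd i -> coprime i A by move=> oi; rewrite coprimeXr// coprimen2.
have dvk d : (d %| k)%N -> [/\ (0 < d)%N, k = (k %/ d * d)%N, odd d & odd (k %/ d)].
  move=> dk; have dkE := divnK dk; rewrite dkE (dvdn_gt0 k0 dk).
  by move: ok; rewrite -{1}dkE oddM => /andP[? ?].
(* The part of the sum with a given parity of i is carried by any enumeration
   [s] of the divisors of that parity with a cofactor of the other one. *)
have E (b : bool) (s : seq nat) : uniq s ->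
    (s =i [pred i | [&& (0 < i)%N, odd i == b, (i %| n.*2)%N
                     & odd (i + n.*2 %/ i)]]) ->
    \sum_(1 <= i < n.*2.+1 | odd i == b) (-1) ^+ i.+1 * (progression_mem i n)%:R
    = (-1) ^+ b.+1 * (\sum_(i <- s) (i < n.*2 %/ i))%N%:R :> int.
  move=> us sE; rewrite natr_sum mulr_sumr.
  rewrite (bigID [pred i | (i %| n.*2)%N && odd (i + n.*2 %/ i)])/=.
  rewrite [X in _ + X]big_nat_cond [X in _ + X]big1 ?addr0; last first.
    move=> i /andP[/andP[i0 _] /andP[_]].
    rewrite progression_memE// negb_and.
    by move=> /orP[] /negbTE ->; rewrite ?andbF ?mulr0.
  rewrite -big_filter (perm_big s) /=.
    rewrite big_seq [RHS]big_seq; apply: eq_bigr => i; rewrite sE inE.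
    move=> /and4P[i0 /eqP <- idvd oi]; rewrite progression_memE// idvd oi andbT.
    by rewrite !exprS signr_odd.
  apply: uniq_perm => //; first by rewrite filter_uniq// iota_uniq.
  move=> i; rewrite sE mem_filter mem_index_iota inE ltnS.
  case: (posnP i) => [->|i0]; first by rewrite !andbF.
  have [idvd|] := boolP (i %| _)%N; last by rewrite !andbF.
  by rewrite /= dvdn_leq// ?andbT// double_gt0.
rewrite (bigID (fun i => odd i == true))/= (E true (divisors k))//; last 2 first.
- exact: divisors_uniq.
- move=> i; rewrite -dvdn_divisors// inE nk; apply/idP/and4P => [ik|[i0 /eqP oi]].
    have [i0 kE oi oki] := dvk _ ik.
    by rewrite oi -muln_divA// oddD oi oddM evA dvdn_mull.
  by rewrite Gauss_dvdr// coA.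
under [X in _ + X]eq_bigl => i do rewrite eqb_id -eqbF_neg.
(* An odd cofactor of an even i absorbs no power of 2, so 2 ^ a divides i. *)
rewrite (E false [seq A * d | d <- divisors k]%N)//; last 2 first.
- rewrite map_inj_uniq ?divisors_uniq// => x y /eqP.
  by rewrite eqn_pmul2l// => /eqP.
- move=> i; rewrite inE nk; apply/mapP/and4P => [[d]|[i0 /eqP oi iAk]].
    rewrite -dvdn_divisors// => dk ->; have [d0 kE od okd] := dvk _ dk.
    by rewrite muln_gt0 A0 d0 divnMl// oddD oddM evA dvdn_pmul2l//= dk okd.
  rewrite oddD oi /= => oq.
  have : (A %| i)%N.
    rewrite -(@Gauss_dvdl _ _ (A * k %/ i)); last by rewrite coprime_sym coA.
    by rewrite muln_divA// mulKn// dvdn_mulr.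
  case/dvdnP => d iE; exists d; last by rewrite mulnC.
  by rewrite -dvdn_divisors// -(dvdn_pmul2l A0) mulnC -iE.
rewrite big_map /= expr2 mulrNN !mul1r expr1 mulN1r.
rewrite -sum1_count [in RHS]big_mkcond /= !natr_sum -sumrB.
rewrite big_seq [RHS]big_seq; apply: eq_bigr => d; rewrite -dvdn_divisors// => dk.
have [d0 kE od oq] := dvk _ dk.
rewrite nk -muln_divA// divnMl// /central_divisor; set q := (k %/ d)%N in oq *.
(* The two cutoffs, d < A q and A d < q, differ exactly by centrality because
   the odd q cannot equal the even A d. *)
have qAd : q != (A * d)%N by apply/eqP => /(congr1 odd); rewrite oq oddM evA.
have dAq : (A * d < q)%N -> (d < A * q)%N by nia.
case: (ltngtP q (A * d)%N) (qAd) dAq => // _ _; first by rewrite andbT subr0.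
by move=> ->; rewrite //= subrr.
Qed.

(** * The values equal to 2 *)

Lemma odd_dvdn_ge3 (d m : nat) : odd m -> (d %| m)%N -> d != m ->
  (3 * d <= m)%N.
Proof.
move=> om /dvdnP[c mE] dm; move: om; rewrite mE oddM => /andP[oc _].
rewrite leq_mul2r orbC; case: c mE oc => [|[|[|c]]]//.
by rewrite mul1n => /eqP; rewrite eq_sym (negbTE dm).
Qed.

(** A divisor d of p m is either a divisor of m or p times one, and the two kinds
are exchanged by d |-> p m / d.  If d | m and d <> m, then d <= m / 3 and
p m / d >= 3 p, so centrality would force 9 p < 2^a m.  This leaves m and p. *)
Lemma h_prime_mul_eq2 (h : nat -> int) (n a p m : nat) : h_identity h ->
  prime p -> odd p -> odd m -> (m < p)%N ->
  (p < 2 ^ a * m)%N -> (2 ^ a * m < 9 * p)%N ->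
  n.*2 = (2 ^ a * (p * m))%N -> h n = 2.
Proof.
move=> hh pp op om mp lo hi nE.
have p0 := prime_gt0 pp; have m0 : (0 < m)%N by case: (m) om.
have A0 : (0 < 2 ^ a)%N by rewrite expn_gt0.
have n0 : (0 < n)%N by rewrite -double_gt0 nE !muln_gt0 A0 p0 m0.
have pm0 : (0 < p * m)%N by rewrite muln_gt0 p0.
rewrite (h_central_divisors hh n0 _ nE) ?oddM ?op//; congr _%:R.
have npm : ~~ (p %| m)%N by rewrite gtnNdvd.
rewrite -size_filter -[RHS]/(size [:: m; p]); apply: perm_size.
apply: uniq_perm; first by rewrite filter_uniq// divisors_uniq.
  by rewrite /= inE andbT neq_ltn mp.
move=> d; rewrite mem_filter -dvdn_divisors// !inE /central_divisor.
apply/andP/orP => [[/andP[c1 c2] ddvd]|].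
  have kE := divnK ddvd; set q := (_ %/ d)%N in kE c1 c2.
  have d0 : (0 < d)%N by rewrite (dvdn_gt0 pm0).
  have mono x : (3 * x <= m)%N -> (3 * (2 ^ a * x) <= 2 ^ a * m)%N.
    by move=> xm; rewrite mulnCA leq_mul2l xm orbT.
  have [/dvdnP[d' dE]|pd] := boolP (p %| d)%N.
    have qm : (q * d')%N = m.
      by apply/eqP; rewrite -(eqn_pmul2l p0) -kE dE [eqbRHS]mulnA [eqbLHS]mulnC.
    have q0 : (0 < q)%N by move: m0; rewrite -qm muln_gt0 => /andP[].
    right; have [q_m|qm3] := eqVneq q m.
      move: qm; rewrite q_m -[RHS]muln1 => /eqP; rewrite eqn_pmul2l// dE.
      by move=> /eqP ->; rewrite mul1n.
    have q3 : (3 * q <= m)%N by apply: odd_dvdn_ge3 => //; rewrite -qm dvdn_mulr.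
    have d'3 : (3 <= d')%N by rewrite -(leq_pmul2l q0) qm mulnC.
    have : (3 * p <= d)%N by rewrite dE leq_mul2r d'3 orbT.
    have := mono _ q3; lia.
  left; apply: contraT => dm.
  have dvdm : (d %| m)%N.
    by move: ddvd; rewrite Gauss_dvdr// coprime_sym prime_coprime.
  have d3 := odd_dvdn_ge3 om dvdm dm.
  have : (3 * p <= q)%N.
    by rewrite -(leq_pmul2r d0) kE -mulnA mulnCA leq_mul2l d3 orbT.
  have := mono _ d3; lia.
have mAp : (m < 2 ^ a * p)%N by rewrite (leq_trans mp)// leq_pmull.
case=> /eqP ->; first by rewrite mulnK// mAp lo dvdn_mull.
by rewrite mulKn// mAp lo dvdn_mulr.
Qed.

Lemma h_semiprime_eq2 (h : nat -> int) (p1 p2 : nat) : h_identity h ->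
  prime p2 -> odd p1 -> odd p2 -> (p1 < p2)%N -> (p2 < 2 * p1)%N ->
  h (p1 * p2)%N = 2.
Proof.
move=> hh pp2 o1 o2 lt12 lt21.
by apply: (@h_prime_mul_eq2 h _ 1 p2 p1) => //; rewrite ?expn1; lia.
Qed.

(** Here 2^a m' = 2 m for the odd part m' of m, which lies in the
window between p and 9 p because m is p - 1 or p + 1 and p >= 3. *)
Lemma h_prime_mul_near_eq2 (h : nat -> int) (p m : nat) : h_identity h ->
  prime p -> odd p -> ~~ odd m -> (p.-1 <= m <= p.+1)%N -> h (p * m)%N = 2.
Proof.
move=> hh pp op em /andP[lom him].
have p3 : (3 <= p)%N by have := prime_gt1 pp; case: (p) op => [|[|[|]]].
have m0 : (0 < m)%N by lia.
have [m' com' mE] := pfactor_coprime (isT : prime 2) m0.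
have om' : odd m' by rewrite -coprime2n.
have m'm : (2 * m' <= m)%N.
  case: (logn 2 m) mE => [|b] mE; first by move: em; rewrite mE muln1 om'.
  by rewrite mE expnS mulnCA leq_mul2l leq_pmulr ?orbT// expn_gt0.
have E : (2 ^ (logn 2 m).+1 * m' = 2 * m)%N by rewrite expnS mulnAC -mulnA -mE.
apply: (@h_prime_mul_eq2 h _ (logn 2 m).+1 p m') => //; rewrite ?E; try lia.
by rewrite mulnCA E -mul2n mulnCA.
Qed.

(** * A Chebyshev lower bound for primes *)

(** Compare Vandermonde's sum of the squares of the binomials of n with the sum
of the binomials themselves. *)
Lemma expn2_leq_central_bin (n : nat) : (2 ^ n <= 'C(n.*2, n))%N.
Proof.
have -> : (2 ^ n)%N = (\sum_(i < n.+1) 'C(n, i))%N.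
  by rewrite -[2%N]/(1 + 1)%N expnDn; apply: eq_bigr => i _; rewrite !exp1n !muln1.
rewrite -addnn -binomial.Vandermonde; apply: leq_sum => i _.
by rewrite leq_pmulr// bin_gt0 leq_subr.
Qed.

(** In Legendre's formula for (2n)! / (n!)^2, each power p^k <= 2n contributes
floor(2n / p^k) - 2 floor(n / p^k), which is 0 or 1, and larger powers
contribute nothing; so the exponent is at most the largest k with p^k <= 2n. *)
Lemma logn_central_bin (p n : nat) : prime p -> (0 < n)%N ->
  (p ^ logn p 'C(n.*2, n) <= n.*2)%N.
Proof.
move=> pp n0; have p1 := prime_gt1 pp.
apply: leq_trans (trunc_logP p1 _); last by rewrite double_gt0.
rewrite leq_exp2l//; set L := trunc_log _ _.
have ln : (logn p n`!) = (\sum_(1 <= k < n.*2.+1) n %/ p ^ k)%N.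
  rewrite logn_fact// [RHS](big_cat_nat _ (n := n.+1))//=; last by lia.
  rewrite [X in (_ + X)%N]big_nat [X in (_ + X)%N]big1 ?addn0// => k /andP[nk _].
  by rewrite divn_small// (ltn_trans nk)// ltn_expl.
have : logn p (n.*2)`! = (logn p 'C(n.*2, n) + (logn p n`!).*2)%N.
  have nn2 : (n <= n.*2)%N by lia.
  rewrite -(bin_fact nn2) (_ : n.*2 - n = n)%N; last by lia.
  by rewrite !lognM ?bin_gt0 ?muln_gt0 ?fact_gt0// addnn.
rewrite ln logn_fact// -[X in (_ + X)%N]muln2 big_distrl /=.
have : (\sum_(1 <= k < n.*2.+1) n.*2 %/ p ^ k <=
        \sum_(1 <= k < n.*2.+1) ((n %/ p ^ k) * 2 + (k <= L)))%N.
  apply: leq_sum => k _; have pk : (0 < p ^ k)%N by rewrite expn_gt0 (ltnW p1).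
  case: (leqP k L) => kL.
    by rewrite -ltnS -addnS ltn_divLR//; have := ltn_ceil n pk; nia.
  rewrite divn_small// (leq_trans (trunc_log_ltn _ p1))//.
  by rewrite leq_exp2l.
rewrite big_split /=.
have : (\sum_(1 <= k < n.*2.+1) (k <= L) <= L)%N.
  rewrite -big_mkcond /= sum1_count -size_filter -[leqRHS](size_iota 1).
  apply: uniq_leq_size; first by rewrite filter_uniq// iota_uniq.
  by move=> k; rewrite mem_filter !mem_index_iota mem_iota; lia.
by lia.
Qed.

(** Each of the primes dividing 'C(2n, n) is at most 2n and contributes a factor
at most 2n. *)
Lemma central_bin_leq (n : nat) : (0 < n)%N ->
  ('C(n.*2, n) <= n.*2 ^ count prime (iota 1 n.*2))%N.
Proof.
move=> n0; have C0 : (0 < 'C(n.*2, n))%N by rewrite bin_gt0; lia.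
rewrite {1}(prod_prime_decomp C0) prime_decompE big_map /=.
set s := primes _.
have ps p : p \in s -> prime p && (p ^ logn p 'C(n.*2, n) <= n.*2)%N.
  by rewrite mem_primes => /and3P[pp _ _]; rewrite pp logn_central_bin.
apply: (@leq_trans (\prod_(p <- s) n.*2)%N).
  rewrite big_seq [leqRHS]big_seq.
  by apply: leq_prod => p /ps/andP[].
rewrite big_const_seq count_predT iter_muln_1 leq_pexp2l ?double_gt0//.
rewrite -size_filter; apply: uniq_leq_size => [|p pS]; first exact: primes_uniq.
have /andP[pp pn] := ps _ pS; rewrite mem_filter pp mem_iota add1n ltnS prime_gt0//=.
apply: leq_trans pn; move: pS; rewrite -logn_gt0.
by case: (logn _ _) => // k _; rewrite expnS leq_pmulr// expn_gt0 prime_gt0.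
Qed.

(** * Counting the values equal to 2 *)

Definition odd_primes (n : nat) : seq nat :=
  [seq p <- iota 1 n | prime p && odd p].

Lemma count_prime_odd_primes (n : nat) :
  (count prime (iota 1 n) <= (size (odd_primes n)).+1)%N.
Proof.
rewrite -size_filter -[leqRHS]/(size (2%N :: odd_primes n)).
apply: uniq_leq_size => [|p]; first by rewrite filter_uniq ?iota_uniq.
rewrite inE !mem_filter => /andP[pp ->]; rewrite pp andbT /=.
by case: (even_prime pp) => ->; rewrite ?orbT.
Qed.

Lemma odd_primes_leq_count_eq2 (R : realType) (h : nat -> int) (X : R) (n : nat) :
  h_identity h -> (n * n.+1 <= Num.truncn X)%N ->
  (size (odd_primes n) <= count_eq2 h X)%N.
Proof.
move=> hh nX; rewrite /count_eq2 cardE -(size_map val).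
rewrite -(size_map (fun p => p * p.+1)%N); apply: uniq_leq_size.
  rewrite map_inj_uniq ?filter_uniq ?iota_uniq// => p q; nia.
move=> _ /mapP[p + ->]; rewrite mem_filter mem_iota add1n ltnS.
move=> /andP[/andP[pp op] /andP[p0 pn]].
have pX : (p * p.+1 < (Num.truncn X).+1)%N.
  by rewrite ltnS (leq_trans _ nX)// leq_mul.
apply/mapP; exists (Ordinal pX) => //.
rewrite mem_enum inE /= muln_gt0 p0 /=.
by apply/eqP/h_prime_mul_near_eq2; rewrite //= ?op// leqnn andbT; lia.
Qed.

Lemma h_ge0 (h : nat -> int) (n : nat) : h_identity h -> (0 < n)%N -> 0 <= h n.
Proof.
move=> hh n0; have n20 : (0 < n.*2)%N by rewrite double_gt0.
have [k cok nE] := pfactor_coprime (isT : prime 2) n20.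
rewrite mulnC in nE.
by rewrite (h_central_divisors hh n0 _ nE) ?ler0n// -coprime2n.
Qed.

Lemma double_count_eq2_le (R : realType) (h : nat -> int) (X : R) :
  h_identity h -> (2 * count_eq2 h X <= Num.truncn X)%N.
Proof.
move=> hh; set N := Num.truncn X.
rewrite -(ler_nat int) (le_trans _ (sum_h_le N hh))//.
rewrite /count_eq2 -/N -sum1_card natrM natr_sum mulr_sumr.
rewrite big_geq_mkord big_mkcond [leRHS]big_mkcond /=.
apply: ler_sum => i _; rewrite inE.
by case: posnP => //= i0; case: eqP => [->//|_]; apply: h_ge0.
Qed.

Lemma chebyshev_odd_primes (R : realType) (n : nat) : (0 < n)%N ->
  n%:R * ln 2 <= (size (odd_primes n.*2)).+1%:R * ln (n.*2)%:R :> R.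
Proof.
move=> n0; rewrite ![_ * ln _]mulr_natl -!lnXn ?ltr0n ?double_gt0//.
rewrite ler_ln ?posrE ?exprn_gt0 ?ltr0n ?double_gt0// -!natrX ler_nat.
apply: leq_trans (expn2_leq_central_bin n) (leq_trans (central_bin_leq n0) _).
by rewrite leq_pexp2l ?double_gt0// count_prime_odd_primes.
Qed.

(** With s the square root of X, take n = floor (s / 3): then 2n + 1 <= 3n <= s,
so p (p + 1) <= X for all p <= 2n, while n >= s / 6.  Writing P for the number
of odd primes up to 2n, P >= 1 gives 2 P >= P + 1, which absorbs the prime 2,
and ln X = 2 ln s turns n ln 2 <= (P + 1) ln (2n) into the claim. *)
Lemma sqrt_div_ln_le_count (R : realType) (h : nat -> int) (X : R) :
  h_identity h -> 36 <= X ->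
  ln 2 / 6 * (Num.sqrt X / ln X) <= (count_eq2 h X)%:R.
Proof.
move=> hh X36; set s := Num.sqrt X; have X0 : 0 <= X by lra.
have sX : s ^+ 2 = X by rewrite sqr_sqrtr.
have s6 : 6 <= s by rewrite -(@ler_pXn2r _ 2) ?nnegrE ?sqrtr_ge0// sX; lra.
pose n := Num.truncn (s / 3).
have /andP[ns sn] : n%:R <= s / 3 < n.+1%:R by apply: truncn_itv; lra.
have n2 : (2 <= n)%N by rewrite truncn_ge_nat ?ler_pdivlMr; lra.
have n2R : 2 <= n%:R :> R by rewrite ler_nat.
rewrite -[n.+1%:R]natr1 in sn.
have nX : (n.*2 * n.*2.+1 <= Num.truncn X)%N.
  rewrite truncn_ge_nat// -sX expr2 natrM ler_pM//.
    by rewrite -mul2n natrM; move: n2R ns; move: (n%:R : R) => t; lra.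
  by rewrite -natr1 -mul2n natrM; lra.
have := odd_primes_leq_count_eq2 hh nX; rewrite -(ler_nat R).
apply: le_trans; set P := size _.
have P1 : 1 <= P%:R :> R.
  rewrite ler1n /P size_filter -has_count; apply/hasP; exists 3%N => //.
  by rewrite mem_iota; lia.
have lns : 0 < ln s by rewrite ln_gt0; lra.
have lnX : ln X = 2 * ln s by rewrite -sX lnXn ?mulr_natl//; lra.
have l2 : 0 < ln 2 :> R by rewrite ln_gt0 ?ltr1n.
have lnn : ln (n.*2)%:R <= ln s.
  by rewrite ler_ln ?posrE ?ltr0n ?double_gt0 -?mul2n ?natrM; lra || lia.
have := @chebyshev_odd_primes R n (ltnW n2); rewrite -/P -[P.+1%:R]natr1 => H.
rewrite lnX mulrA ler_pdivrMr ?mulr_gt0//.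
have le1 : ln 2 / 6 * s <= n%:R * ln 2.
  have -> : ln 2 / 6 * s = s / 6 * ln 2 by ring.
  rewrite ler_pM2r//. lra.
have le2 : (P%:R + 1) * ln (n.*2)%:R <= (P%:R + 1) * ln s.
  by rewrite ler_pM2l//; lra.
have le3 : (P%:R + 1) * ln s <= (2 * P%:R) * ln s.
  by rewrite ler_pM2r//; lra.
rewrite [leRHS]mulrCA mulrA; apply: le_trans le3.
exact: le_trans le1 (le_trans H le2).
Qed.

Theorem theorem1p3 (R : realType) (h : nat -> int) (h_def : h_identity h) :
  [/\ asymp_ll (fun X : R => Num.sqrt X / ln X)
               (fun X : R => (count_eq2 h X)%:R) /\
      (\forall X \near +oo_R,
         (count_eq2 h X)%:R <
           X / 2 + (3 / 2 + Num.sqrt 2) * Num.sqrt X + 1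
           + 3 * Num.sqrt 2 / 2),
      (forall p1 p2 : nat, prime p1 -> prime p2 -> odd p1 -> odd p2 ->
         (p1 < p2)%N -> (p2 < 2 * p1)%N -> h (p1 * p2)%N = 2)
    & (forall p : nat, prime p -> odd p ->
         h (p * (p + 1))%N = 2 /\ h ((p - 1) * p)%N = 2)].
Proof.
split; [split| |].
- exists (ln 2 / 6); first by rewrite divr_gt0// ln_gt0 ?ltr1n.
  apply: filterS (nbhs_pinfty_ge (num_real 36)) => X.
  exact: sqrt_div_ln_le_count.
- apply: filterS (nbhs_pinfty_ge (num_real 0)) => X X0.
  have : (2 * count_eq2 h X)%:R <= X.
    by rewrite (le_trans _ (_ : (Num.truncn X)%:R <= X)) ?truncn_le//
      ler_nat double_count_eq2_le.
  have s2 := sqrtr_ge0 (2 : R).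
  have : 0 <= (3 / 2 + Num.sqrt 2) * Num.sqrt X.
    by rewrite mulr_ge0 ?sqrtr_ge0//; lra.
  rewrite natrM; lra.
- by move=> p1 p2 _ pp2 o1 o2; apply: h_semiprime_eq2.
- move=> p pp op; have p0 := prime_gt0 pp.
  split; last rewrite mulnC; apply: h_prime_mul_near_eq2 => //.
  + by rewrite addn1 /= op.
  + by rewrite addn1 leqnn andbT; lia.
  + by rewrite oddB// op.
  + by rewrite subn1 leqnn; lia.
Qed.
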